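(* Let $A$ be an $n\times n$ irreducible stochastic matrix. If $A$ is periodic, then $\det(I-A^{[2]})=0$.
   Context: $A$ is periodic if its digraph (vertices $\{1,\ldots,n\}$, edge $i\to j$ iff $A_{ij}>0$) admits a partition $\{P_1,\ldots,P_t\}$ with $t\ge2$ such that every edge from $P_k$ ends in $P_{k+1}$ (indices mod $t$). $A^{[2]}$ is the $\binom n2\times\binom n2$ matrix with rows and columns indexed by pairs $(i,j)$ with $1\le i<j\le n$, whose entry in row $(i,j)$ and column $(l,m)$ ($l<m$) is $A_{il}A_{jm}+A_{im}A_{jl}$ (the permanent of the $2\times2$ submatrix of $A$ with rows $i,j$ and columns $l,m$). $I$ is the identity matrix of that size. *)

(* Defs.v *)
From HB Require Import structures.
From mathcomp Require Import all_boot all_order all_algebra.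

Set Implicit Arguments.
Unset Strict Implicit.
Unset Printing Implicit Defensive.

Import Order.TTheory GRing.Theory Num.Theory.
Local Open Scope ring_scope.

Definition stochastic (R : realFieldType) (n : nat) (A : 'M[R]_n) : Prop :=
  (forall i j, 0 <= A i j) /\ (forall i, \sum_j A i j = 1).

Definition digraph (R : realFieldType) (n : nat) (A : 'M[R]_n) : rel 'I_n :=
  fun i j => 0 < A i j.

(* Strong connectivity of the digraph.  [connect] is reflexive, so every       *)
(* 1 x 1 matrix qualifies; the disputed case, the zero matrix, is not          *)
(* stochastic.                                                                *)
Definition irreducible (R : realFieldType) (n : nat) (A : 'M[R]_n) : Prop :=
  forall i j, connect (digraph A) i j.

(* [partition] makes the blocks nonempty, pairwise disjoint and covering;      *)
(* injectivity makes the t indexed blocks distinct.  [ordS] is the cyclic      *)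
(* successor k |-> k + 1 mod t.                                                *)
Definition periodic (R : realFieldType) (n : nat) (A : 'M[R]_n) : Prop :=
  exists (t : nat) (P : 'I_t -> {set 'I_n}),
    [/\ (2 <= t)%N,
        injective P,
        partition [set P k | k : 'I_t] [set: 'I_n]
      & forall (k : 'I_t) (i j : 'I_n),
          i \in P k -> digraph A i j -> j \in P (ordS k)].

Definition ordpair (n : nat) : finType :=
  {p : 'I_n * 'I_n | (p.1 < p.2)%N}.

Lemma card_ordpair (n : nat) : #|ordpair n| = 'C(n, 2).
Proof.
rewrite card_sig -sum1_card -bin2_sum big_mkord.
rewrite -(pair_big_dep xpredT (fun i j : 'I_n => (i < j)%N) (fun _ _ => 1%N)) /=.
rewrite (exchange_big_dep xpredT) //=; apply: eq_bigr => j _.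
by rewrite (big_ord_narrow (ltnW (ltn_ord j))) sum_nat_const card_ord muln1.
Qed.

(* Rows and columns are numbered through the enumeration of the pairs (i, j),  *)
(* i < j; the size #|ordpair n| is 'C(n, 2) by [card_ordpair].                 *)
Definition perm2_mx (R : realFieldType) (n : nat) (A : 'M[R]_n) :
    'M[R]_#|ordpair n| :=
  \matrix_(r, c)
    let: (i, j) := val (enum_val r) in
    let: (l, m) := val (enum_val c) in
    A i l * A j m + A i m * A j l.

(* Main.v *)
Require Import Defs.
From HB Require Import structures.
From mathcomp Require Import all_boot all_order all_algebra.

Set Implicit Arguments.
Unset Strict Implicit.
Unset Printing Implicit Defensive.

Import Order.TTheory GRing.Theory Num.Theory.
Local Open Scope ring_scope.

(** [perm2_mx A] describes two independent walkers as an unordered pair that is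
    lost as soon as they meet.  Along edges the class of each walker advances
    by one, so walkers in different classes never meet and walkers in the same
    class remain so: the indicator of the pairs lying in different classes is
    fixed by [perm2_mx A]. *)

(** The diagonal contributes nothing, and swapping coordinates carries the pairs below it to those
    above it. *)
Lemma sum_ordpair_sym (V : nmodType) (n : nat) (F : 'I_n -> 'I_n -> V) :
  (forall i, F i i = 0) ->
  \sum_(p : ordpair n) (F (val p).1 (val p).2 + F (val p).2 (val p).1) =
  \sum_i \sum_j F i j.
Proof.
move=> F0; rewrite pair_big /=.
rewrite -(big_sub (fun p : 'I_n * 'I_n => (p.1 < p.2)%N)
  (fun p => F p.1 p.2 + F p.2 p.1)) /=.
rewrite big_split /= [RHS](bigID (fun p : 'I_n * 'I_n => p.1 < p.2)%N) /=.
congr (_ + _).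
rewrite [RHS](bigID (fun p : 'I_n * 'I_n => p.1 == p.2)) /= [X in X + _]big1.
  rewrite add0r (reindex_inj (can_inj swap_pairK)) /=.
  apply: eq_big => [[i j]|[i j] _] //=.
  by rewrite unfold_in /= -leqNgt ltn_neqAle andbC eq_sym.
by case=> i j /= /andP[_ /eqP->]; rewrite F0.
Qed.

(** The two terms of the permanent are the two orders in which the walkers can reach [l] and [m].
    Symmetry of [w] gives both the same weight, and [w l l = 0] makes up for the missing
    diagonal. *)
Lemma perm2_mxE (R : realFieldType) (n : nat) (A : 'M[R]_n)
    (w : 'I_n -> 'I_n -> R) (r : 'I_#|ordpair n|) :
  (forall i, w i i = 0) -> (forall i j, w i j = w j i) ->
  (perm2_mx A *m \col_s w (val (enum_val s)).1 (val (enum_val s)).2) r 0 =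
  \sum_l \sum_m A (val (enum_val r)).1 l * A (val (enum_val r)).2 m * w l m.
Proof.
move=> w0 wC; case def_r: (val (enum_val r)) => [i j] /=.
rewrite -sum_ordpair_sym => [|l]; last by rewrite w0 mulr0.
rewrite mxE [RHS](reindex _ (onW_bij _ (enum_val_bij _))).
apply: eq_bigr => s _.
rewrite !mxE def_r; case: (enum_val s) => -[l m] _ /=.
by rewrite mulrDl (wC m l).
Qed.

Lemma periodic_class (R : realFieldType) (n : nat) (A : 'M[R]_n) :
  periodic A ->
  exists (t : nat) (c : 'I_n -> 'I_t),
    [/\ (2 <= t)%N, forall k, exists i, c i = k
      & forall i j, digraph A i j -> c j = ordS (c i)].
Proof.
case=> t [P [t2 injP /and3P[/eqP cov /trivIsetP triv nz] step]].
have inP i : exists k, i \in P k.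
  have: i \in cover [set P k | k : 'I_t] by rewrite cov inE.
  by case/bigcupP=> _ /imsetP[k _ ->]; exists k.
have uniqP i k l : i \in P k -> i \in P l -> k = l.
  move=> ik il; apply/eqP/contraT=> kl.
  (* Distinct indices give distinct, hence disjoint, blocks, yet [i] would lie in both. *)
  have /pred0P/(_ i)/= := triv _ _ (imset_f P (erefl (k \in 'I_t)))
    (imset_f P (erefl (l \in 'I_t))) (contra_neq (@injP _ _) kl).
  by rewrite ik il.
pose c i := xchoose (inP i); have cP i : i \in P (c i) := xchooseP (inP i).
exists t, c; split=> // [k|i j ij].
  have [E|[i ik]] := set_0Vmem (P k); last by exists i; apply: uniqP ik.
  by case/negP: nz; rewrite -E imset_f.
by apply: uniqP (cP j) _; apply: step ij.
Qed.

Theorem mainTheorem11 (R : realFieldType) (n : nat) (A : 'M[R]_n) :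
  stochastic A -> irreducible A -> periodic A ->
  \det (1%:M - perm2_mx A) = 0.
Proof.
move=> [A0 A1] _ /periodic_class[t [c [t2 c_surj step]]].
pose w i j : R := (c i != c j)%:R.
have w0 i : w i i = 0 by rewrite /w eqxx.
have wC i j : w i j = w j i by rewrite /w eq_sym.
(* Without both edges each side is 0; with them, injectivity of [ordS] preserves whether the classes
   differ. *)
have w_step i j l m : A i l * A j m * w l m = A i l * A j m * w i j.
  have [il|] := boolP (digraph A i l); last first.
    by rewrite /digraph lt0r A0 andbT negbK => /eqP->; rewrite !mul0r.
  have [jm|] := boolP (digraph A j m); last first.
    by rewrite /digraph lt0r A0 andbT negbK => /eqP->; rewrite mulr0 !mul0r.
  by rewrite /w (step _ _ il) (step _ _ jm) (inj_eq (@ordS_inj t)).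
pose v := \col_s w (val (@enum_val (ordpair n) predT s)).1
                   (val (enum_val s)).2.
have vfix : perm2_mx A *m v = v.
  apply/colP=> r; rewrite perm2_mxE // [RHS]mxE.
  case: (val (enum_val r)) => i j /=.
  (* The weight no longer depends on [l] and [m], so it factors out and two row sums equal to 1
     remain. *)
  under eq_bigr do under eq_bigr do rewrite w_step.
  under eq_bigr do rewrite -mulr_suml -mulr_sumr A1 mulr1.
  by rewrite -mulr_suml A1 mul1r.
have v_neq0 : v != 0.
  (* Classes 0 and 1 both exist since [2 <= t]; vertices chosen from them give an entry of [v] equal
     to 1. *)
  have [i ci] := c_surj (Ordinal (ltnW t2)).
  have [j cj] := c_surj (Ordinal t2).
  have cij : c i != c j by rewrite ci cj.
  wlog ij : i j cij {ci cj} / (i < j)%N => [IH|].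
    case: (ltngtP i j) => [|ji|/val_inj E]; first exact: IH.
      by apply: IH ji; rewrite eq_sym.
    by rewrite E eqxx in cij.
  apply/eqP=> /colP/(_ (enum_rank (exist _ (i, j) ij : ordpair n))).
  by rewrite !mxE enum_rankK /= /w cij => /eqP; rewrite oner_eq0.
(* [det0P] asks for a row vector in the left kernel, hence the transposes. *)
rewrite -det_tr; apply/eqP/det0P; exists v^T; first by rewrite trmx_eq0.
by rewrite -trmx_mul mulmxBl mul1mx vfix subrr trmx0.
Qed.
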